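(* Let $0<p\leq 2$. There is a constant $A_p>0$, depending only on $p$, such that the following holds for every $f\in H^p(\delta^2)$, $f\neq 0$, with Haar expansion $$f=\sum_{I\times J\in\mathcal{R}} f_{IJ}\,h_{I\times J}$$ and atomic decomposition $(f_n,\mathcal{R}_n)_{n\in\mathbb{Z}}$. The sequence $(\omega_{IJ})_{I\times J\in\mathcal{R}}$ of non-negative numbers defined by $$\omega_{IJ}=\frac{1}{A_p\,\|f\|^{p}_{H^p(\delta^2)}}\;\frac{|\mathcal{R}_n^*|^{1-\frac p2}\,f_{IJ}^2\,|I|\,|J|}{\|f_n\|_{2}^{2-p}},\qquad I\times J\in\mathcal{R}_n,\ n\in\mathbb{Z}$$ (with $\omega_{IJ}=0$ whenever $f_{IJ}=0$, in particular if $I\times J\in\mathcal{R}_n$ with $f_n=0$ or if $I\times J$ belongs to no $\mathcal{R}_n$), satisfies $$\sum_{I\times J\in\mathcal{R}}\omega_{IJ}\leq 1,$$ and for each $\varphi=(\varphi_{IJ})_{I\times J\in\mathcal{R}}\in\ell^\infty(\mathcal{R})$ the following inequality holds: $$\|\mathcal{M}_f(\varphi)\|_{H^p(\delta^2)}\leq A_p\,\|f\|_{H^p(\delta^2)}\Big(\sum_{I\times J\in\mathcal{R}}|\varphi_{IJ}|^2\,\omega_{IJ}\Big)^{\frac12}.$$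
   Context: Dyadic intervals: $\mathcal{D}=\{[2^{-n}(k-1),2^{-n}k) : n\in\mathbb{N}_0,\ 1\leq k\leq 2^n\}$. Dyadic rectangles: $\mathcal{R}=\mathcal{D}\times\mathcal{D}$, whose elements are written $I\times J$ with $I,J\in\mathcal{D}$. $|\cdot|$ denotes Lebesgue measure of a set (in dimension one or two), and $m$ is Lebesgue measure on $[0,1]^2$. For a collection $\mathcal{C}\subseteq\mathcal{R}$, $\mathcal{C}^*\subseteq[0,1]^2$ denotes the pointset covered by the union of all rectangles in $\mathcal{C}$. $1_A$ is the indicator function of $A$. Haar functions: for $I\in\mathcal{D}$, $h_I$ is $+1$ on the left half of $I$, $-1$ on the right half of $I$, and $0$ on $[0,1]\setminus I$; $h_{I\times J}(s,t)=h_I(s)h_J(t)$. $\ell^\infty(\mathcal{R})$ is the space of all bounded (real) sequences $\varphi=(\varphi_{IJ})_{I\times J\in\mathcal{R}}$ with norm $\|\varphi\|_\infty=\sup_{I\times J\in\mathcal{R}}|\varphi_{IJ}|$. Hardy space: for a real vector $f=(f_{IJ})_{I\times J\in\mathcal{R}}$, the square function is $S(f)(s,t)=\big(\sum_{I\times J\in\mathcal{R}}f_{IJ}^2\,1_{I\times J}(s,t)\big)^{1/2}$, $(s,t)\in[0,1]^2$. For $0<p\leq2$, $H^p(\delta^2)$ consists of all such $f$ with $$\|f\|_{H^p(\delta^2)}=\Big(\int_{[0,1]^2}S(f)^p\,dm\Big)^{1/p}<\infty.$$ Write $\|f\|_2=\|f\|_{H^2(\delta^2)}$. A vector $f=(f_{IJ})\in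 H^p(\delta^2)$ is identified with its formal Haar series $f=\sum_{I\times J\in\mathcal{R}}f_{IJ}h_{I\times J}$. Multiplication operator: for $f\in H^p(\delta^2)$, $\mathcal{M}_f:\ell^\infty(\mathcal{R})\to H^p(\delta^2)$ is given by $\mathcal{M}_f(\varphi)=\sum_{I\times J\in\mathcal{R}}\varphi_{IJ}f_{IJ}h_{I\times J}$. Atomic decomposition of $f\in H^p(\delta^2)$: for $n\in\mathbb{Z}$ put $F_n=\{(s,t)\in[0,1]^2: S(f)(s,t)>2^n\}$, $$\mathcal{R}_n=\Big\{I\times J\in\mathcal{R}:\ |(I\times J)\cap F_n|>\tfrac{|I\times J|}{2},\ |(I\times J)\cap F_{n+1}|\leq\tfrac{|I\times J|}{2}\Big\},$$ and $f_n=\sum_{I\times J\in\mathcal{R}_n}f_{IJ}h_{I\times J}$. The collections $\mathcal{R}_n$ are pairwise disjoint, and every $I\times J$ with $f_{IJ}\neq0$ belongs to exactly one of them. The family $(f_n,\mathcal{R}_n)_{n\in\mathbb{Z}}$ is called the atomic decomposition of $f$. *)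

(* Defs.v *)
From HB Require Import structures.
From mathcomp Require Import all_boot all_order all_algebra.
From mathcomp Require Import all_classical all_reals all_analysis.
From mathcomp Require Import measurable_realfun.
Set Implicit Arguments.
Unset Strict Implicit.
Unset Printing Implicit Defensive.
Import Order.TTheory GRing.Theory Num.Theory.
Import numFieldNormedType.Exports.
Local Open Scope classical_set_scope.
Local Open Scope ring_scope.

(* The pair (n, k) with k < 2 ^ n stands for [2 ^ -n * k, 2 ^ -n * (k + 1)[;
   distinct pairs give distinct intervals, so indexing by codes is the same
   as indexing by the intervals themselves. *)
Definition dyadic : Type := {n : nat & 'I_(2 ^ n)}.

Definition dyadic_rect : Type := (dyadic * dyadic)%type.

Section ProductHardySpace.
Context {R : realType}.

Local Notation plane := (measurableTypeR R * measurableTypeR R)%type.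

Definition dint (I : dyadic) : set R :=
  `[(tagged I)%:R / 2 ^+ tag I, (tagged I).+1%:R / 2 ^+ tag I[.

Definition drect (Q : dyadic_rect) : set plane := dint Q.1 `*` dint Q.2.

Definition leb2 : set plane -> \bar R :=
  (@lebesgue_measure R \x @lebesgue_measure R)%E.
HB.instance Definition _ := Measure.on leb2.

Definition unit_square : set plane := `[0, 1] `*` `[0, 1].

(* The pointset covered by a collection of dyadic rectangles. *)
Definition cover_set (C : set dyadic_rect) : set plane :=
  \bigcup_(Q in C) drect Q.

(* A vector (f_Q) is identified with the formal Haar series of coefficients
   f_Q, so the Haar functions themselves do not enter the definitions below. *)
Definition square_fun (f : dyadic_rect -> R) (x : plane) : \bar R :=
  ((\esum_(Q in [set: dyadic_rect]) (f Q ^+ 2 * \1_(drect Q) x)%:E)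
     `^ 2^-1)%E.

Definition Hnorm (p : R) (f : dyadic_rect -> R) : \bar R :=
  ((\int[leb2]_(x in unit_square) (square_fun f x `^ p)) `^ p^-1)%E.

Definition Hspace (p : R) : set (dyadic_rect -> R) :=
  [set f | (Hnorm p f < +oo)%E].

(* The multiplication operator M_f : phi |-> sum_Q phi_Q f_Q h_Q. *)
Definition mult_op (f phi : dyadic_rect -> R) : dyadic_rect -> R :=
  fun Q => phi Q * f Q.

Definition level_set (f : dyadic_rect -> R) (n : int) : set plane :=
  unit_square `&` [set x | ((2 ^ n)%:E < square_fun f x)%E].

Definition atom_rects (f : dyadic_rect -> R) (n : int) : set dyadic_rect :=
  [set Q | (leb2 (drect Q) * 2^-1%:E < leb2 (drect Q `&` level_set f n))%E /\
    (leb2 (drect Q `&` level_set f (n + 1)) <= leb2 (drect Q) * 2^-1%:E)%E].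

Definition atom (f : dyadic_rect -> R) (n : int) : dyadic_rect -> R :=
  fun Q => f Q * \1_(atom_rects f n) Q.

(* All the extended reals under [fine] are finite when f is in H^p and Q is
   in [atom_rects f n]. *)
Definition weight_at (A p : R) (f : dyadic_rect -> R) (n : int)
    (Q : dyadic_rect) : R :=
  (A * fine (Hnorm p f) `^ p)^-1 *
  (fine (leb2 (cover_set (atom_rects f n))) `^ (1 - p / 2) * f Q ^+ 2 *
    fine (lebesgue_measure (dint Q.1)) * fine (lebesgue_measure (dint Q.2)) /
    fine (Hnorm 2 (atom f n)) `^ (2 - p)).

(* The index n with Q in [atom_rects f n] is unique when it exists: see
   [weightE]. *)
Definition weight (A p : R) (f : dyadic_rect -> R) (Q : dyadic_rect) : R :=
  if (f Q != 0) && `[< exists n, atom_rects f n Q >]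
  then weight_at A p f (xget 0 [set n | atom_rects f n Q]) Q
  else 0.

Lemma measurable_drect Q : measurable (drect Q).
Proof. by apply: measurableX; exact: measurable_itv. Qed.

Lemma measurable_square_fun f : measurable_fun setT (square_fun f).
Proof.
apply: (measurableT_comp (measurable_poweR _)).
pose g (x : plane) (Q : dyadic_rect) : \bar R :=
  (f Q ^+ 2 * \1_(drect Q) x)%:E.
pose h (i : nat) (x : plane) : \bar R :=
  if unpickle i is Some Q then g x Q else 0%E.
pose P : set nat := range (@pickle dyadic_rect).
have g0 x Q : (0 <= g x Q)%E by rewrite lee_fin mulr_ge0// ?sqr_ge0.
rewrite (_ : (fun x => _) = fun x => (\sum_(i <oo | i \in P) h i x)%E); last first.
  apply/funext => x; rewrite nneseries_esum; last first.
    by move=> i _; rewrite /h; case: unpickle.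
  rewrite (_ : [set x0 | _] = P); last by apply/seteqP; split => i /=; rewrite inE.
  rewrite (@reindex_esum _ _ _ [set: dyadic_rect] P pickle).
    by apply: eq_esum => Q _; rewrite /h pickleK.
  by split => // Q _; exists Q.
apply: (@ge0_emeasurable_sum _ _ _ setT h [pred i | i \in P]).
  by move=> i x _ _; rewrite /h; case: unpickle.
move=> i _; rewrite /h; case: unpickle => [Q|]; last exact: measurable_cst.
apply/measurable_EFinP; apply: measurable_funM => //.
by apply: measurable_indic; exact: measurable_drect.
Qed.

Lemma measurable_level_set f n : measurable (level_set f n).
Proof.
apply: measurableI; first by apply: measurableX; exact: measurable_itv.
rewrite -[X in measurable X]setTI.
by apply: emeasurable_fun_o_infty => //; exact: measurable_square_fun.
Qed.

Lemma atom_rects_inj f n m Q :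
  atom_rects f n Q -> atom_rects f m Q -> n = m.
Proof.
wlog nm : n m / (n < m)%R => [H hn hm|[_ hn] [hm _]].
  by case: (ltgtP n m) => // nm; [exact: H|apply/esym; exact: H].
suff hmn : (leb2 (drect Q `&` level_set f m) <=
            leb2 (drect Q `&` level_set f (n + 1)))%E.
  by have := lt_le_trans hm (le_trans hmn hn); rewrite ltxx.
apply: (le_measure leb2); rewrite ?inE.
- by apply: measurableI; [exact: measurable_drect|exact: measurable_level_set].
- by apply: measurableI; [exact: measurable_drect|exact: measurable_level_set].
apply: setIS => x [Qx] /= mx; split => //=; apply: le_lt_trans mx.
by rewrite lee_fin ler_weXz2l ?ler1n// lezD1.
Qed.

Lemma weightE A p f n Q :
  atom_rects f n Q -> weight A p f Q = weight_at A p f n Q.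
Proof.
move=> Qn; rewrite /weight; case: eqVneq => [fQ0|_].
  rewrite /weight_at fQ0 expr0n /=.
  move: (_ `^ _) (_^-1) (fine _) (fine _) (_^-1) => a b c d e.
  by rewrite mulr0 !mul0r mulr0.
have -> : xget 0 [set k | atom_rects f k Q] = n.
  by case: xgetP => [k _ Qk|/(_ n)]; [exact: atom_rects_inj Qk Qn|].
have /asboolP -> : exists k, atom_rects f k Q by exists n.
by [].
Qed.

End ProductHardySpace.

(* Main.v *)
Require Import Defs.
From HB Require Import structures.
From mathcomp Require Import all_boot all_order all_algebra.
From mathcomp Require Import all_classical all_reals all_analysis.
From mathcomp Require Import measurable_realfun zify ring lra.
Set Implicit Arguments.
Unset Strict Implicit.
Unset Printing Implicit Defensive.
Import Order.TTheory GRing.Theory Num.Theory.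
Import numFieldNormedType.Exports.
Local Open Scope classical_set_scope.
Local Open Scope ring_scope.

(** Write t = p / 2, N for the integral of S(f) ^ p over the unit square, m_n
    for the area of the shadow of R_n (the union of its rectangles) and e_n for
    the squared H^2 norm of f_n. Everything rests on two estimates.

    First, e_n <= 8 * 4 ^ n * m_n ([energy_atom_le]): a rectangle of R_n keeps
    half of its area off F_(n+1), where S(f) <= 2 ^ (n + 1), so integrating
    S(f_n) ^ 2 off F_(n+1) recovers at least half of e_n.

    Secondly, the sum over n of (8 * 4 ^ n) ^ t * m_n is at most C N for a
    constant C depending only on p ([cover_sum_le]). Indeed m_n <= 576 |F_n|
    ([dense_drects_cover_le]), because a rectangle half filled by a set has many
    slices quarter filled by it, which reduces the strong maximal estimate for
    indicators to the one-dimensional weak (1,1) inequality applied in each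
    variable; and the sum over n of 4 ^ (n t) |F_n| is at most a constant times
    N, since at each point it reduces to a geometric series with largest term
    below S(f) ^ p.

    The total weight carried by R_n is m_n ^ (1 - t) * e_n ^ t divided by A N,
    hence at most (8 * 4 ^ n) ^ t * m_n / (A N), and the weights add up to at
    most 1 as soon as C <= A ([weight_sum_le]).

    For the norm inequality, the first estimate shows that the weight of a
    rectangle Q of R_n is at least f_Q ^ 2 |Q| (8 * 4 ^ n) ^ (t - 1) / (A N).
    Let X be the sum over n and over Q in R_n of
    (phi_Q f_Q) ^ 2 (8 * 4 ^ n) ^ (t - 1) 1_Q, and let Y be the sum over n of
    (8 * 4 ^ n) ^ t times the indicator of the shadow of R_n. A point of a
    rectangle of R_n satisfies (8 * 4 ^ n) ^ t <= Y, so that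
    S(M_f phi) ^ p <= X ^ t * Y ^ (1 - t) pointwise. The integral of X is at
    most A N times the weighted sum of the squares of phi, that of Y is at most
    C N, and Hoelder's inequality gives the claim with A = C ^ (2 / p). *)

(** * Countable sums of extended reals *)

Section countable_sums.
Context {R : realType} (T : countType).
Local Open Scope ereal_scope.
Implicit Types a b : T -> \bar R.

(** Enumerating the index type turns an unordered sum into a series, to which
    the monotone convergence theorem applies. *)
Lemma esum_nneseries a : (forall i, 0 <= a i) ->
  \esum_(i in [set: T]) a i = \sum_(n <oo) oapp a 0 (@pickle_inv T n).
Proof.
move=> a0; rewrite nneseries_esumT; last by move=> n; case: pickle_inv => /=.
pose P : set nat := range (@pickle T).
transitivity (\esum_(n in P) oapp a 0 (@pickle_inv T n)).
  rewrite esum_image; last by move=> i j _ _; exact: (pcan_inj pickleK).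
  by apply: eq_esum => i _; rewrite pickleK_inv.
rewrite esum_mkcond; apply: eq_esum => n _; case: ifPn => //.
rewrite notin_setE => Pn; have := @pickle_invK T n.
by case: pickle_inv => [i|]//= iE; case: Pn; exists i.
Qed.

Lemma esumZl a (c : R) : (0 <= c)%R -> (forall i, 0 <= a i) ->
  \esum_(i in [set: T]) (c%:E * a i) = c%:E * \esum_(i in [set: T]) a i.
Proof.
move=> c0 a0; rewrite !esum_nneseries// => [|i]; last by rewrite mule_ge0.
rewrite -nneseriesZl//; last by move=> n _; case: pickle_inv => /=.
by apply: eq_eseriesr => n _; case: pickle_inv => //=; rewrite mule0.
Qed.

(** The factor may be infinite: then either every term of the second family
    vanishes, or the right-hand side is infinite. *)
Lemma le_esumZr a b (y : \bar R) : 0 <= y -> (forall i, 0 <= b i) ->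
  (forall i, a i <= b i * y) ->
  \esum_(i in [set: T]) a i <= (\esum_(i in [set: T]) b i) * y.
Proof.
move=> y0 b0 aby; case: y y0 aby => [y| |//] y0 aby.
  by rewrite muleC -esumZl//; apply: le_esum => i _; rewrite muleC.
have [bi0|/existsNP[i bi0]] := pselect (forall i, b i = 0).
  rewrite (esum1 (fun i _ => bi0 i)) mul0e.
  rewrite -[leRHS](@esum1 R T setT (fun=> 0))//.
  by apply: le_esum => i _; rewrite (le_trans (aby i))// bi0 mul0e.
rewrite gt0_muley ?leey// (@lt_le_trans _ _ (b i))//.
  by rewrite lt_neqAle eq_sym b0 andbT; apply/eqP.
by apply: esum_ge; exists [set i] => //; rewrite fsbig_set1.
Qed.

Lemma esum_ge_term a i : (forall i, 0 <= a i) ->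
  a i <= \esum_(i in [set: T]) a i.
Proof. by move=> a0; apply: esum_ge; exists [set i] => //; rewrite fsbig_set1. Qed.

End countable_sums.

Lemma exchange_esum (R : realType) (S T : choiceType) (a : S -> T -> \bar R) :
  (forall i j, 0 <= a i j)%E ->
  (\esum_(i in [set: S]) \esum_(j in [set: T]) a i j =
   \esum_(j in [set: T]) \esum_(i in [set: S]) a i j)%E.
Proof.
move=> a0; rewrite !esum_esum//.
rewrite (@reindex_esum _ _ _ ([set: S] `*`` (fun=> [set: T]))
  ([set: T] `*`` (fun=> [set: S])) (fun k => (k.2, k.1)))//.
split => //= [[i j] [i' j'] _ _ [-> ->]//|[j i] _].
by exists (i, j).
Qed.

Section integral_esum.
Context d (X : measurableType d) (R : realType).
Variable mu : {measure set X -> \bar R}.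
Context (T : countType) (D : set X) (mD : measurable D).
Variable f : T -> X -> \bar R.
Hypothesis mf : forall i, measurable_fun D (f i).
Hypothesis f0 : forall i x, (0 <= f i x)%E.
Local Open Scope ereal_scope.

Lemma measurable_fun_esum :
  measurable_fun D (fun x => \esum_(i in [set: T]) f i x).
Proof.
under eq_fun do rewrite esum_nneseries//.
apply: ge0_emeasurable_sum => [n x _ _|n _]; first by case: pickle_inv => /=.
by case: pickle_inv => [i|] /=; [exact: mf|exact: measurable_cst].
Qed.

Lemma integral_esum :
  \int[mu]_(x in D) (\esum_(i in [set: T]) f i x) =
  \esum_(i in [set: T]) \int[mu]_(x in D) f i x.
Proof.
under eq_integral do rewrite esum_nneseries//.
rewrite integral_nneseries//=; last 2 first.
- by move=> n; case: pickle_inv => [i|] /=; [exact: mf|exact: measurable_cst].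
- by move=> n x _; case: pickle_inv => /=.
rewrite esum_nneseries//; last by move=> i; exact: integral_ge0.
by apply: eq_eseriesr => n _; case: pickle_inv => //=; rewrite integral0.
Qed.

End integral_esum.

(** * Hoelder's inequality for products of powers *)

Section hoelder_poweR.
Context {R : realType}.
Local Open Scope ereal_scope.

(** Infinite values have to be allowed, since the series to which the inequality
    is applied may diverge at some points. *)
Lemma young_poweR (x y : \bar R) (t : R) : (0 < t)%R -> (t <= 1)%R ->
  0 <= x -> 0 <= y ->
  x `^ t * y `^ (1 - t) <= t%:E * x + (1 - t)%:E * y.
Proof.
move=> t0; rewrite le_eqVlt => /predU1P[->|t1] x0 y0.
  by rewrite subrr poweRe0 poweRe1// mule1 mul1e mul0e adde0.
have t1' : (0 < 1 - t)%R by rewrite subr_gt0.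
case: x x0 => [x x0|_|//]; last first.
  by rewrite gt0_muley// addye ?leey// gt_eqF// (@lt_le_trans _ _ 0)// mule_ge0// lee_fin ltW.
case: y y0 => [y y0|_|//]; last by rewrite gt0_muley// addey ?leey.
rewrite /= -!EFinM -EFinD lee_fin; rewrite !lee_fin in x0 y0.
have := @conjugate_powR R (x `^ t)%R (y `^ (1 - t))%R t^-1%R (1 - t)^-1%R
  (powR_ge0 _ _) (powR_ge0 _ _).
rewrite !invr_gt0 => /(_ t0 t1'); rewrite !invrK subrKC => /(_ erefl).
rewrite -!powRrM !divff ?gt_eqF// !powRr1// => /le_trans; apply.
by rewrite mulrC (mulrC y).
Qed.

Context d (X : measurableType d) (mu : {measure set X -> \bar R}).
Context (D : set X) (mD : measurable D) (u v w : X -> \bar R) (t : R).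
Hypotheses (meas_u : measurable_fun D u) (meas_v : measurable_fun D v)
  (meas_w : measurable_fun D w).
Hypotheses (u0 : forall x, 0 <= u x) (v0 : forall x, 0 <= v x)
  (w0 : forall x, 0 <= w x).
Hypotheses (t0 : (0 < t)%R) (t1 : (t <= 1)%R).
Hypothesis wuv : forall x, D x -> w x <= u x `^ t * v x `^ (1 - t).

Let integral_hoelder_fin (a b : R) : (0 < a)%R -> (0 < b)%R ->
  \int[mu]_(x in D) u x <= a%:E -> \int[mu]_(x in D) v x <= b%:E ->
  \int[mu]_(x in D) w x <= a%:E `^ t * b%:E `^ (1 - t).
Proof.
move=> a0 b0 ua vb; pose k := ((a `^ t) * (b `^ (1 - t)))%R.
have k0 : (0 < k)%R by rewrite mulr_gt0// powR_gt0.
have ta : (0 <= t / a)%R by rewrite divr_ge0// ltW.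
have tb : (0 <= (1 - t) / b)%R by rewrite divr_ge0// ?subr_ge0// ltW.
have m1 : measurable_fun D (fun x => (t / a)%:E * u x) by exact: measurable_funeM.
have m2 : measurable_fun D (fun x => ((1 - t) / b)%:E * v x)
  by exact: measurable_funeM.
have -> : a%:E `^ t * b%:E `^ (1 - t) = k%:E by rewrite /= -EFinM.
apply: (@le_trans _ _ (\int[mu]_(x in D)
    (k%:E * ((t / a)%:E * u x + ((1 - t) / b)%:E * v x)))).
  apply: ge0_le_integral => //.
    by apply: measurable_funeM; exact: emeasurable_funD.
  move=> x Dx; apply: (le_trans (wuv Dx)).
  rewrite (EFinM t) (EFinM (1 - t)) -!muleA.
  have E (c : R) (z : \bar R) : (0 < c)%R -> z = c%:E * ((c^-1)%:E * z).
    by move=> c0; rewrite muleA -EFinM divff ?mul1e// gt_eqF.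
  rewrite {1}(E a (u x))// {1}(E b (v x))//.
  rewrite (@poweRM _ a%:E) ?mule_ge0 ?lee_fin ?invr_ge0 ?(ltW a0)//.
  rewrite (@poweRM _ b%:E) ?mule_ge0 ?lee_fin ?invr_ge0 ?(ltW b0)//.
  rewrite muleACA /= -EFinM -/k. rewrite lee_pmul2l//.
  by rewrite young_poweR// mule_ge0// lee_fin invr_ge0 ltW.
have [ua0 vb0] : 0 <= \int[mu]_(x in D) u x /\ 0 <= \int[mu]_(x in D) v x.
  by split; exact: integral_ge0.
rewrite ge0_integralZl//; last 3 first.
- exact: emeasurable_funD.
- by move=> x _; rewrite adde_ge0// mule_ge0.
- by rewrite lee_fin ltW.
rewrite ge0_integralD//; last 2 first.
- by move=> x _; rewrite mule_ge0.
- by move=> x _; rewrite mule_ge0.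
rewrite !ge0_integralZl// -[leRHS]mule1 lee_pmul2l//.
have -> : (1 : \bar R) = (t / a)%:E * a%:E + ((1 - t) / b)%:E * b%:E.
  by rewrite -!EFinM -EFinD !divfK ?gt_eqF// subrKC.
by rewrite leeD// lee_wpmul2l.
Qed.

(** Young's inequality is applied pointwise to u and v normalized by the bounds
    a and b of their integrals, which requires a > 0; the case a = 0 is
    recovered by letting a positive bound tend to 0. *)
Lemma integral_hoelder_poweR (a : \bar R) (b : R) : 0 <= a -> (0 < b)%R ->
  \int[mu]_(x in D) u x <= a -> \int[mu]_(x in D) v x <= b%:E ->
  \int[mu]_(x in D) w x <= a `^ t * b%:E `^ (1 - t).
Proof.
move=> + b0 + vb; case: a => [a|_ _|//]; last first.
  by rewrite poweRyr ?gt_eqF// gt0_mulye ?leey// poweR_gt0.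
rewrite lee_fin le_eqVlt => /predU1P[<- ua|]; last first.
  by move=> a0 ua; exact: integral_hoelder_fin.
rewrite poweR0r ?gt_eqF// mul0e; apply/lee_addgt0Pr => e e0; rewrite add0e.
(* u has integral 0, so any a' > 0 bounds it; this a' turns the bound into e *)
pose a' := ((e / b `^ (1 - t)) `^ t^-1)%R.
have c0 : (0 < b `^ (1 - t))%R by exact: powR_gt0.
have a'0 : (0 < a')%R by rewrite powR_gt0// divr_gt0.
have ua' : \int[mu]_(x in D) u x <= a'%:E.
  by rewrite (le_trans ua)// lee_fin ltW.
have := integral_hoelder_fin a'0 b0 ua' vb.
rewrite /= -EFinM /a' -powRrM mulVf ?gt_eqF// powRr1 ?divfK ?gt_eqF//.
by rewrite divr_ge0// ltW.
Qed.

End hoelder_poweR.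

(** * Dyadic intervals filled by a set on the line *)

Section dyadic_density.
Context {R : realType}.
Local Notation leb := (@lebesgue_measure R).
Local Open Scope ereal_scope.

Lemma measurable_dint (I : dyadic) : measurable (dint I : set (measurableTypeR R)).
Proof. exact: measurable_itv. Qed.

Lemma lebesgue_dint (I : dyadic) : leb (dint I) = (2 ^- tag I)%:E.
Proof.
rewrite lebesgue_measure_itv/= lte_fin ltr_pM2r ?invr_gt0 ?exprn_gt0//.
by rewrite ltr_nat ltnSn -EFinB -mulrBl -natrB// subSnn mul1r.
Qed.

Lemma measurable_bigcup_dint (P : set dyadic) :
  measurable (\bigcup_(I in P) dint I : set (measurableTypeR R)).
Proof.
rewrite bigcup_mkcond; apply: countable_bigcupT_measurable => [|I]; first exact: countableP.
by case: ifPn => // _; exact: measurable_dint.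
Qed.

Definition dense_dints (c : R) (E : set R) : set dyadic :=
  [set I | c%:E * leb (dint I) < leb (dint I `&` E)].

(** Around each point of a dyadic interval of length r that E fills up to a
    proportion c, the ball of radius r contains the interval and has length
    2r, so that the Hardy-Littlewood maximal function of the indicator of E
    exceeds c / 2 there: the bound is the weak (1,1) inequality. *)
Lemma dense_dints_cover_le (c : R) (E : set R) : (0 < c)%R ->
  measurable (E : set (measurableTypeR R)) ->
  leb (\bigcup_(I in dense_dints c E) dint I) <= (6 / c)%:E * leb E.
Proof.
move=> c0 mE.
have lE : locally_integrable setT (\1_E : R -> R).
  by apply: locally_integrable_indic => //; exact: openT.
have c20 : (0 < c / 2)%R by rewrite divr_gt0.
have := maximal_inequality lE c20.
have -> : \int[leb]_(y in setT) `|(\1_E y)%:E| = leb E.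
  under eq_integral do rewrite /= ger0_norm//.
  by rewrite integral_indic// setIT.
have -> : (3 / (c / 2) = 6 / c :> R)%R by field; rewrite gt_eqF.
apply: le_trans; apply: le_measure; rewrite ?inE.
- exact: measurable_bigcup_dint.
- rewrite -[X in measurable X]setTI.
  by apply: emeasurable_fun_o_infty => //; exact: measurable_HL_maximal.
move=> x [I EI Ix] /=.
pose r : R := (2 ^- tag I)%R.
have r0 : (0 < r)%R by rewrite invr_gt0 exprn_gt0.
have Ir : dint I `<=` ball x r.
  move=> y Iy; move: Ix Iy; rewrite /dint /= !in_itv/= => /andP[ax xb] /andP[ay yb].
  rewrite /ball/= ltr_distl.
  have ab : ((tagged I).+1%:R / 2 ^+ tag I = (tagged I)%:R / 2 ^+ tag I + r :> R)%R.
    by rewrite -natr1 mulrDl mul1r.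
  move: xb yb; rewrite ab => xb yb; apply/andP; split; lra.
apply: (@lt_le_trans _ _ (iavg (\1_E : R -> R) (ball x r))); last first.
  by apply: ereal_sup_ubound; exists r => //=; rewrite in_itv/= r0.
rewrite /iavg.
have -> : \int[leb]_(y in ball x r) `|(\1_E y)%:E| = leb (E `&` ball x r).
  under eq_integral do rewrite /= ger0_norm//.
  by rewrite integral_indic//; exact: measurable_ball.
rewrite lebesgue_measure_ball ?ltW// inver ifF; last by rewrite mulrn_eq0 (gt_eqF r0).
rewrite lte_pdivlMl ?mulrn_wgt0// -EFinM.
have -> : (r *+ 2 * (c / 2) = c * r)%R by rewrite -mulr_natr; field.
rewrite EFinM -lebesgue_dint (lt_le_trans EI)// setIC.
apply: le_measure; rewrite ?inE; last exact: setIS.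
- by apply: measurableI => //; exact: measurable_dint.
- by apply: measurableI => //; exact: measurable_ball.
Qed.

End dyadic_density.

(** * Dyadic rectangles filled by a set in the plane *)

Section strong_density.
Context {R : realType}.
Local Notation leb := (@lebesgue_measure R).
Local Notation plane := (measurableTypeR R * measurableTypeR R)%type.
Local Notation leb2 := (@leb2 R).
Local Open Scope ereal_scope.
Implicit Types F G : set plane.

Lemma leb2_xsection F : leb2 F = \int[leb]_x leb (xsection F x).
Proof. by []. Qed.

Lemma leb2_ysection F : measurable F ->
  leb2 F = \int[leb]_y leb (ysection F y).
Proof.
move=> mF; apply: (@product_measure_unique _ _ _ _ _ leb leb (leb \x^ leb)) => //.
by move=> A B mA mB; exact: product_measure2E.
Qed.

Lemma measurable_cover_set (C : set dyadic_rect) :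
  measurable (cover_set C : set plane).
Proof.
rewrite /cover_set bigcup_mkcond; apply: countable_bigcupT_measurable => [|Q].
  exact: countableP.
by case: ifPn => // _; exact: measurable_drect.
Qed.

Definition xdense (J : dyadic) F : set (measurableTypeR R) :=
  [set x | dense_dints 4^-1 (xsection F x) J].

Definition ydense (I : dyadic) F : set (measurableTypeR R) :=
  [set y | dense_dints 4^-1 (ysection F y) I].

(** On each vertical line, [xfill F] is the union of the dyadic intervals that
    the slice of F fills to more than a quarter; [yfill F] is the analogue for
    horizontal lines. *)
Definition xfill F : set plane := \bigcup_J (xdense J F `*` dint J).

Definition yfill F : set plane := \bigcup_I (dint I `*` ydense I F).

Lemma measurable_xdense J F : measurable F -> measurable (xdense J F).
Proof.
move=> mF; rewrite -[X in measurable X]setTI.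
apply: emeasurable_fun_o_infty => //.
have := @measurable_fun_xsection _ _ _ _ R leb ((setT `*` dint J) `&` F).
move=> /(_ (measurableI _ _ (measurableX measurableT (measurable_dint J)) mF)).
congr measurable_fun; apply/funext => x /=; rewrite xsectionI in_xsectionX ?inE//.
Qed.

Lemma measurable_ydense I F : measurable F -> measurable (ydense I F).
Proof.
move=> mF; rewrite -[X in measurable X]setTI.
apply: emeasurable_fun_o_infty => //.
have := @measurable_fun_ysection _ _ _ _ R leb ((dint I `*` setT) `&` F).
move=> /(_ (measurableI _ _ (measurableX (measurable_dint I) measurableT) mF)).
congr measurable_fun; apply/funext => x /=; rewrite ysectionI in_ysectionX ?inE//.
Qed.

Lemma measurable_xfill F : measurable F -> measurable (xfill F).
Proof.
move=> mF; apply: countable_bigcupT_measurable => [|J]; first exact: countableP.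
by apply: measurableX; [exact: measurable_xdense|exact: measurable_dint].
Qed.

Lemma measurable_yfill F : measurable F -> measurable (yfill F).
Proof.
move=> mF; apply: countable_bigcupT_measurable => [|J]; first exact: countableP.
by apply: measurableX; [exact: measurable_dint|exact: measurable_ydense].
Qed.

Lemma xfill_le F : measurable F -> leb2 (xfill F) <= 24%:E * leb2 F.
Proof.
move=> mF; rewrite !leb2_xsection -ge0_integralZl//; last first.
  exact: measurable_fun_xsection.
apply: ge0_le_integral => //.
- by apply: measurable_fun_xsection; exact: measurable_xfill.
- by apply: measurable_funeM; exact: measurable_fun_xsection.
move=> x _; rewrite (_ : xsection _ x =
    \bigcup_(J in dense_dints 4^-1 (xsection F x)) dint J); last first.
  apply/seteqP; split => y; rewrite /xsection/= inE.
    by move=> [J _ [/= xJ yJ]]; exists J.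
  by move=> [J xJ yJ]; exists J.
have -> : 24%:E = (6 / 4^-1)%:E :> \bar R by congr EFin; lra.
apply: dense_dints_cover_le; first by rewrite invr_gt0.
exact: measurable_xsection.
Qed.

Lemma yfill_le F : measurable F -> leb2 (yfill F) <= 24%:E * leb2 F.
Proof.
move=> mF; rewrite !leb2_ysection//; last exact: measurable_yfill.
rewrite -ge0_integralZl//; last exact: measurable_fun_ysection.
apply: ge0_le_integral => //.
- by apply: measurable_fun_ysection; exact: measurable_yfill.
- by apply: measurable_funeM; exact: measurable_fun_ysection.
move=> y _; rewrite (_ : ysection _ y =
    \bigcup_(I in dense_dints 4^-1 (ysection F y)) dint I); last first.
  apply/seteqP; split => x; rewrite /ysection/= inE.
    by move=> [J _ [/= xJ yJ]]; exists J.
  by move=> [J xJ yJ]; exists J.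
have -> : 24%:E = (6 / 4^-1)%:E :> \bar R by congr EFin; lra.
apply: dense_dints_cover_le; first by rewrite invr_gt0.
exact: measurable_ysection.
Qed.

(** If F fills more than half of I x J, then for a proportion larger than 1/4
    of the points x of I, the slice of F at x fills more than a quarter of J;
    these points x satisfy {x} x J <= xfill F. *)
Lemma drect_sub_fill (Q : dyadic_rect) F : measurable F ->
  leb2 (drect Q) * 2^-1%:E < leb2 (drect Q `&` F) ->
  drect Q `<=` yfill (xfill F).
Proof.
case: Q => I J mF /= QF [x y] [/= Ix Jy].
exists I => //; split => //=.
rewrite /ydense /dense_dints/=.
have mB := measurable_xdense J mF.
apply: (@lt_le_trans _ _ (leb (dint I `&` xdense J F))); last first.
  apply: le_measure; rewrite ?inE.
  - by apply: measurableI => //; exact: measurable_dint.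
  - apply: measurableI; first exact: measurable_dint.
    by apply: measurable_ysection; exact: measurable_xfill.
  by apply: setIS => z Bz; rewrite /ysection/= inE; exists J.
rewrite ltNge; apply/negP => IB.
move: QF; rewrite ltNge => /negP; apply.
rewrite [leb2 (drect _)]product_measure1E; [|exact: measurable_dint..].
have mI : measurable (dint I : set (measurableTypeR R)) by exact: measurable_dint.
have mIB : measurable (dint I `&` xdense J F : set (measurableTypeR R)).
  by apply: measurableI => //; exact: measurable_dint.
have m1 : measurable_fun setT
    (fun z : measurableTypeR R => (\1_(dint I `&` xdense J F) z)%:E : \bar R).
  by apply/measurable_EFinP; exact: measurable_indic.
have m2 : measurable_fun setT (fun z : measurableTypeR R => (\1_(dint I) z)%:E : \bar R).
  by apply/measurable_EFinP; exact: measurable_indic.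
rewrite leb2_xsection.
apply: (@le_trans _ _ (\int[leb]_z (leb (dint J) * (\1_(dint I `&` xdense J F) z)%:E
   + 4^-1%:E * leb (dint J) * (\1_(dint I) z)%:E))).
  apply: ge0_le_integral => //.
  - apply: measurable_fun_xsection; apply: measurableI => //.
    exact: measurable_drect.
  - apply: emeasurable_funD; exact: measurable_funeM.
  move=> z _; rewrite xsectionI.
  have [Iz|Iz] := boolP (z \in dint I); last first.
    rewrite notin_xsectionX// set0I measure0.
    by rewrite adde_ge0// !mule_ge0.
  rewrite in_xsectionX// !indicE Iz in_setI Iz /= mule1.
  have [zB|zB] := boolP (z \in xdense J F); rewrite ?mule1 ?mule0 ?add0e.
    rewrite (@le_trans _ _ (leb (dint J)))// ?leeDl ?mule_ge0//.
    apply: le_measure; rewrite ?inE; [|exact: measurable_dint|exact: subIsetl].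
    apply: measurableI; first exact: measurable_dint.
    exact: measurable_xsection.
  by move: zB; rewrite notin_setE /xdense /dense_dints/= => /negP; rewrite -leNgt.
rewrite ge0_integralD//; try exact: measurable_funeM; try by move=> z _; rewrite !mule_ge0.
rewrite !ge0_integralZl ?mule_ge0//.
rewrite !integral_indic ?setIT//.
apply: (@le_trans _ _ (leb (dint J) * (4^-1%:E * leb (dint I))
    + 4^-1%:E * leb (dint J) * leb (dint I))).
  by rewrite leeD2r// lee_wpmul2l.
rewrite /= !lebesgue_dint.
by rewrite -!EFinM -EFinD lee_fin; lra.
Qed.

(** The strong maximal estimate for indicators, obtained by two applications
    of the one-dimensional one. *)
Lemma dense_drects_cover_le F (C : set dyadic_rect) : measurable F ->
  (forall Q, C Q -> leb2 (drect Q) * 2^-1%:E < leb2 (drect Q `&` F)) ->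
  leb2 (cover_set C) <= 576%:E * leb2 F.
Proof.
move=> mF CF.
have mG := measurable_xfill mF; have mH := measurable_yfill mG.
apply: (@le_trans _ _ (leb2 (yfill (xfill F)))).
  apply: le_measure; rewrite ?inE//; first exact: measurable_cover_set.
  by apply: bigcup_sub => Q CQ; apply: drect_sub_fill => //; exact: CF.
rewrite (le_trans (yfill_le mG))//.
have -> : 576%:E = 24%:E * 24%:E :> \bar R by rewrite -EFinM; congr EFin; lra.
by rewrite -muleA lee_pmul2l//; exact: xfill_le.
Qed.

End strong_density.

(** * Square functions and the energy of the atoms *)

Section rect_sums.
Context {R : realType}.
Local Notation plane := (measurableTypeR R * measurableTypeR R)%type.
Local Notation leb2 := (@leb2 R).
Local Notation square := (@unit_square R).
Local Open Scope ereal_scope.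
Implicit Types (c f : dyadic_rect -> R) (x : plane).

Lemma measurable_unit_square : measurable square.
Proof. by apply: measurableX; exact: measurable_itv. Qed.
Hint Resolve measurable_unit_square : core.

Lemma dint_sub01 (I : dyadic) : dint I `<=` (`[0%R, 1%R]%classic : set R).
Proof.
move=> x; rewrite /dint/= !in_itv/= => /andP[lx xr]; apply/andP; split.
  by rewrite (le_trans _ lx)// divr_ge0// exprn_ge0.
rewrite (le_trans (ltW xr))// ler_pdivrMr ?exprn_gt0// mul1r -natrX ler_nat.
exact: ltn_ord.
Qed.

Lemma drect_sub_square Q : drect Q `<=` square.
Proof. by move=> x [/dint_sub01 ? /dint_sub01 ?]. Qed.

Lemma cover_set_sub_square C : cover_set C `<=` square.
Proof. by apply: bigcup_sub => Q _; exact: drect_sub_square. Qed.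

Definition area (Q : dyadic_rect) : R := (2 ^- tag Q.1 * 2 ^- tag Q.2)%R.

Lemma area_gt0 Q : (0 < area Q)%R.
Proof. by rewrite mulr_gt0// invr_gt0 exprn_gt0. Qed.

Lemma leb2_drect Q : leb2 (drect Q) = (area Q)%:E.
Proof.
rewrite [LHS]product_measure1E; [|exact: measurable_dint..].
by rewrite /= !lebesgue_dint -EFinM.
Qed.

Lemma leb2_cover_fin_num C : leb2 (cover_set C) \is a fin_num.
Proof.
rewrite ge0_fin_numE// (@le_lt_trans _ _ (leb2 square))//.
  apply: le_measure; rewrite ?inE//; first exact: measurable_cover_set.
  exact: cover_set_sub_square.
rewrite [leb2 _]product_measure1E; [|exact: measurable_itv..].
by rewrite /= !lebesgue_measure_itv/= lte_fin ltr01 oppr0 adde0 mule1 ltry.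
Qed.

Definition rect_sum c x : \bar R :=
  \esum_(Q in [set: dyadic_rect]) (c Q * \1_(drect Q) x)%:E.

Lemma rect_sum_ge0 c x : (forall Q, 0 <= c Q)%R -> 0 <= rect_sum c x.
Proof. by move=> c0; apply: esum_ge0 => Q _; rewrite lee_fin mulr_ge0. Qed.

Lemma measurable_rect_term c D Q :
  measurable_fun D (fun x : plane => (c Q * \1_(drect Q) x)%:E).
Proof.
apply/measurable_EFinP; apply: measurable_funM => //.
by apply: measurable_indic; exact: measurable_drect.
Qed.

Lemma measurable_rect_sum c D : (forall Q, 0 <= c Q)%R -> measurable D ->
  measurable_fun D (rect_sum c).
Proof.
move=> c0 mD; apply: measurable_fun_esum => [Q|Q x].
  exact: measurable_rect_term.
by rewrite lee_fin mulr_ge0.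
Qed.

Lemma integral_rect_sum c D : (forall Q, 0 <= c Q)%R -> measurable D ->
  \int[leb2]_(x in D) rect_sum c x =
  \esum_(Q in [set: dyadic_rect]) ((c Q)%:E * leb2 (drect Q `&` D)).
Proof.
move=> c0 mD; rewrite integral_esum//; last 2 first.
- by move=> Q; exact: measurable_rect_term.
- by move=> Q x; rewrite lee_fin mulr_ge0.
apply: eq_esum => Q _; under eq_integral do rewrite EFinM.
rewrite ge0_integralZl_EFin//; last first.
  by apply/measurable_EFinP; apply: measurable_indic; exact: measurable_drect.
by rewrite integral_indic//; exact: measurable_drect.
Qed.

Lemma integral_rect_sum_square c : (forall Q, 0 <= c Q)%R ->
  \int[leb2]_(x in square) rect_sum c x =
  \esum_(Q in [set: dyadic_rect]) (c Q * area Q)%:E.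
Proof.
move=> c0; rewrite integral_rect_sum//; apply: eq_esum => Q _.
by rewrite setIidl ?leb2_drect//; exact: drect_sub_square.
Qed.

Lemma square_fun_poweR f x (p : R) :
  square_fun f x `^ p = rect_sum (fun Q => f Q ^+ 2)%R x `^ (p / 2).
Proof. by rewrite /square_fun -poweRrM mulrC. Qed.

Lemma rect_sum_sqr_ge0 f x : 0 <= rect_sum (fun Q => f Q ^+ 2)%R x.
Proof. by apply: rect_sum_ge0 => Q; exact: sqr_ge0. Qed.

Lemma square_fun_ge0 f x : 0 <= square_fun f x.
Proof. exact: poweR_ge0. Qed.

Lemma square_fun_sqr f x :
  square_fun f x `^ 2 = rect_sum (fun Q => f Q ^+ 2)%R x.
Proof. by rewrite square_fun_poweR divff// poweRe1// rect_sum_sqr_ge0. Qed.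

(** The square of the H^2 norm, see [Hnorm2E]. *)
Definition energy f : \bar R :=
  \esum_(Q in [set: dyadic_rect]) (f Q ^+ 2 * area Q)%:E.

Lemma energy_term_ge0 f Q : (0 <= f Q ^+ 2 * area Q)%R.
Proof. by rewrite mulr_ge0 ?sqr_ge0// ltW ?area_gt0. Qed.

Lemma energy_ge0 f : 0 <= energy f.
Proof. by apply: esum_ge0 => Q _; rewrite lee_fin energy_term_ge0. Qed.

Lemma Hnorm2E f : Hnorm 2 f = energy f `^ 2^-1.
Proof.
rewrite /Hnorm; congr (_ `^ _); under eq_integral do rewrite square_fun_sqr.
by rewrite integral_rect_sum_square// => Q; exact: sqr_ge0.
Qed.

Lemma HnormX (p : R) f : (0 < p)%R ->
  Hnorm p f `^ p = \int[leb2]_(x in square) (square_fun f x `^ p).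
Proof.
move=> p0; rewrite /Hnorm -poweRrM mulVf ?gt_eqF// poweRe1//.
by apply: integral_ge0 => x _; exact: poweR_ge0.
Qed.

End rect_sums.
#[global] Hint Resolve measurable_unit_square : core.

Section level_sets.
Context {R : realType} (f : dyadic_rect -> R).
Local Notation plane := (measurableTypeR R * measurableTypeR R)%type.
Local Notation leb2 := (@leb2 R).
Local Notation square := (@unit_square R).
Local Open Scope ereal_scope.
Local Notation cover n := (cover_set (atom_rects f n)).

Let pow2_gt0 (n : int) : (0 < 2 ^ n :> R)%R.
Proof. exact: exprz_gt0. Qed.

Lemma area_le_off_level (n : int) Q : atom_rects f n Q ->
  (area Q)%:E <= 2%:E * leb2 (drect Q `&` (square `\` level_set f (n + 1))).
Proof.
move=> [_]; set F := level_set f (n + 1); set D := square `\` F.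
have mF : measurable F by exact: measurable_level_set.
have mD : measurable D by exact: measurableD.
have mQ := @measurable_drect R Q.
have QE : drect Q = (drect Q `&` F) `|` (drect Q `&` D).
  rewrite -setIUr; apply/esym/setIidl => x Qx.
  have [Fx|Fx] := pselect (F x); first by left.
  by right; split => //; exact: drect_sub_square Qx.
have : leb2 (drect Q) <= leb2 (drect Q `&` F) + leb2 (drect Q `&` D).
  rewrite [in leLHS]QE; apply: measureU2; exact: measurableI.
have : leb2 (drect Q `&` D) <= leb2 (drect Q).
  by apply: le_measure; rewrite ?inE//; exact: measurableI.
have : 0 <= leb2 (drect Q `&` D) by exact: measure_ge0.
have : 0 <= leb2 (drect Q `&` F) by exact: measure_ge0.
rewrite leb2_drect.
case: (leb2 (drect Q `&` D)) => [a| |]//; case: (leb2 (drect Q `&` F)) => [b| |]//.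
by rewrite -!EFinM -EFinD !lee_fin; lra.
Qed.

(** The definition of the level sets bounds S(f) by 2 ^ (n + 1) off
    F_(n+1), and every rectangle of R_n has at least half of its area there;
    so at most half of the energy of f_n is lost by integrating S(f_n) ^ 2 only
    over the part of the shadow of R_n lying off F_(n+1). *)
Lemma energy_atom_le (n : int) :
  energy (atom f n) <= (8 * (2 ^ n) ^+ 2)%:E * leb2 (cover n).
Proof.
pose D : set plane := square `\` level_set f (n + 1).
have mD : measurable D by apply: measurableD => //; exact: measurable_level_set.
have mcov : measurable (cover n : set plane) by exact: measurable_cover_set.
pose c Q : R := (atom f n Q ^+ 2)%R.
have c0 Q : (0 <= c Q)%R by exact: sqr_ge0.
have half : energy (atom f n) <= 2%:E * \int[leb2]_(x in D) rect_sum c x.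
  rewrite integral_rect_sum// -esumZl//; last first.
    by move=> Q; rewrite mule_ge0// lee_fin.
  apply: le_esum => Q _; rewrite muleCA EFinM.
  have [Qn|Qn] := pselect (atom_rects f n Q); last first.
    by rewrite /c /atom indicE memNset// mulr0 expr0n/= !mul0e.
  apply: lee_wpmul2l; first by rewrite lee_fin c0.
  exact: area_le_off_level.
apply: (le_trans half).
have -> : (8 * (2 ^ n) ^+ 2)%:E = 2%:E * ((2 ^ (n + 1)) ^+ 2)%:E :> \bar R.
  by rewrite -EFinM expfzDr// expr1z; congr EFin; ring.
rewrite -muleA lee_pmul2l//.
apply: (@le_trans _ _
    (\int[leb2]_(x in D) (((2 ^ (n + 1)) ^+ 2)%:E * (\1_(cover n) x)%:E))).
  apply: ge0_le_integral => //.
  - by move=> x _; exact: rect_sum_ge0.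
  - exact: measurable_rect_sum.
  - apply: measurable_funeM; apply/measurable_EFinP; exact: measurable_indic.
  move=> x [sx Dx].
  have [nx|nx] := pselect (cover n x); last first.
    rewrite indicE memNset// mule0 le_eqVlt /rect_sum esum1 ?eqxx// => Q _.
    rewrite /c /atom; have [Qx|Qx] := pselect (drect Q x).
      have [Qn|Qn] := pselect (atom_rects f n Q); first by case: nx; exists Q.
      by rewrite [\1_(atom_rects f n) Q]indicE memNset// mulr0 expr0n/= mul0r.
    by rewrite [\1_(drect Q) x]indicE memNset// mulr0.
  rewrite indicE mem_set// mule1.
  apply: (@le_trans _ _ (rect_sum (fun Q => f Q ^+ 2)%R x)).
    apply: le_esum => Q _; rewrite lee_fin ler_wpM2r// /c /atom exprMn.
    rewrite indicE; case: (_ \in _); rewrite ?expr1n ?mulr1//.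
    by rewrite expr0n/= mulr0 sqr_ge0.
  rewrite -square_fun_sqr -powR_mulrn ?(ltW (pow2_gt0 _))// -poweR_EFin.
  apply: gt0_ler_poweR; rewrite ?in_itv/= ?leey ?andbT ?square_fun_ge0//.
    by rewrite lee_fin ltW ?pow2_gt0.
  by rewrite leNgt; apply/negP => lx; apply: Dx; split.
rewrite ge0_integralZl_EFin ?sqr_ge0//; last first.
  by apply/measurable_EFinP; exact: measurable_indic.
rewrite lee_wpmul2l ?lee_fin ?sqr_ge0//.
rewrite integral_indic//; apply: le_measure; rewrite ?inE//.
exact: measurableI.
Qed.

Lemma cover_atom_rects_le (n : int) : leb2 (cover n) <= 576%:E * leb2 (level_set f n).
Proof.
apply: dense_drects_cover_le; first exact: measurable_level_set.
by move=> Q [].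
Qed.

End level_sets.

(** * Summing the measures of the level sets *)

Section layer_cake.
Context {R : realType}.
Local Open Scope ereal_scope.

Lemma geometric_series_le (a r : R) : (0 <= a)%R -> (0 < r)%R -> (r < 1)%R ->
  \sum_(k <oo) (a * r ^+ k)%:E <= (a * (1 - r)^-1)%:E.
Proof.
move=> a0 r0 r1.
have t0 k : (0 <= a * r ^+ k)%R by rewrite mulr_ge0// exprn_ge0// ltW.
apply: lime_le; first by apply: is_cvg_nneseries => k _ _; rewrite lee_fin.
apply: nearW => K; rewrite sumEFin lee_fin big_mkord -mulr_sumr ler_wpM2l//.
have r1' : (0 < 1 - r)%R by rewrite subr_gt0.
rewrite -[leRHS]mul1r ler_pdivlMr// mulrC.
by rewrite -opprB mulNr -subrX1 opprB gerBl exprn_ge0// ltW.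
Qed.

Lemma powR_exprz (p : R) (n : int) :
  ((2 ^ n) `^ p = (2 `^ p) ^ n :> R)%R.
Proof.
rewrite -[in LHS](@powR_intmul R 2 n)// -powRrM mulrC powRrM powR_intmul//.
Qed.

Lemma powR2_gt1 (p : R) : (0 < p)%R -> (1 < 2 `^ p :> R)%R.
Proof.
move=> p0; rewrite -[ltLHS](powRr0 2) /powR pnatr_eq0/= ltr_expR.
by rewrite ltr_pM2r// ln_gt0// ltr1n.
Qed.

(** The powers of 2 below s are the 2 ^ n with n smaller than the ceiling of
    log_2 s, so that their p-th powers form a geometric series. *)
Lemma esum_pow2_lt_le (p : R) (s : \bar R) : (0 < p)%R -> 0 <= s ->
  \esum_(n in [set: int]) ((2 ^ n) `^ p * ((2 ^ n)%:E < s)%E%:R)%:E <=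
  ((1 - (2 `^ p)^-1)^-1)%:E * s `^ p.
Proof.
move=> p0; set q := (2 `^ p)%R; set c := (1 - q^-1)^-1%R.
have q1 : (1 < q)%R by exact: powR2_gt1.
have q0 : (0 < q)%R by exact: lt_trans q1.
have c0 : (0 < c)%R by rewrite invr_gt0 subr_gt0 invf_lt1.
case: s => [s| _|//]; last by rewrite poweRyr ?gt_eqF// gt0_muley// leey.
rewrite lee_fin le_eqVlt => /predU1P[<-|s0].
  rewrite esum1 ?mule_ge0 ?poweR_ge0 ?lee_fin ?(ltW c0)// => n _.
  by rewrite lte_fin ltNge exprz_ge0// mulr0.
pose M := Num.ceil (ln s / ln 2).
have ln20 : (0 < ln (2 : R))%R by rewrite ln_gt0// ltr1n.
have Mlt (n : int) : ((2 ^ n < s) = (n < M))%R.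
  rewrite /M real_ceil_gt_int ?num_real// ltr_pdivlMr// -ln_powR powR_intmul//.
  by rewrite ltr_ln// posrE exprz_gt0.
have -> : \esum_(n in [set: int]) ((2 ^ n) `^ p * ((2 ^ n)%:E < s%:E)%E%:R)%:E =
    \esum_(n in [set n | (n < M)%R]) (q ^ n)%:E.
  rewrite [RHS]esum_mkcond; apply: eq_esum => n _; rewrite lte_fin Mlt.
  rewrite powR_exprz -/q.
  have [nM|nM] := boolP (n < M)%R; rewrite ?mulr1 ?mulr0.
    by rewrite mem_set.
  by rewrite memNset//; exact/negP.
rewrite (@reindex_esum _ _ _ [set: nat] [set n | (n < M)%R]
    (fun k => (M - 1 - k%:Z)%R)); last first.
  split.
  - by move=> k _ /=; lia.
  - by move=> k l _ _ kl; move: kl; lia.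
  - by move=> n /= nM; exists `|(M - 1 - n)%R|%N => //=; lia.
rewrite -nneseries_esumT; last by move=> k; rewrite lee_fin exprz_ge0// ltW.
have -> : (fun n => \sum_(0 <= k < n) (q ^ (M - 1 - k%:Z))%:E) =
          (fun n => \sum_(0 <= k < n) (q ^ (M - 1) * q^-1 ^+ k)%:E).
  apply/funext => n; apply: eq_bigr => k _.
  by rewrite expfzDr ?gt_eqF// -exprz_inv.
apply: le_trans (geometric_series_le _ _ _) _.
- by rewrite exprz_ge0// ltW.
- by rewrite invr_gt0.
- by rewrite invf_lt1.
rewrite -/c /= -EFinM lee_fin mulrC ler_pM2l// -powR_exprz.
apply: ge0_ler_powR; rewrite ?nnegrE ?exprz_ge0 ?(ltW p0) ?(ltW s0)//.
by rewrite ltW// Mlt; lia.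
Qed.

Lemma exists_pow2_gt (x : R) : exists k : nat, (x < 2 ^ k%:Z)%R.
Proof.
exists (Num.bound x); rewrite -exprnP -natrX.
have [x0|x0] := leP 0%R x; last by rewrite (lt_le_trans x0).
by rewrite (lt_trans (archi_boundP x0))// ltr_nat ltn_expl.
Qed.

Lemma exists_pow2_powR_gt (p x : R) : (0 < p)%R ->
  exists k : nat, (x < (2 ^ k%:Z) `^ p)%R.
Proof.
move=> p0; have [x0|x0] := ltP x 0%R.
  by exists 0%N; rewrite (lt_le_trans x0)// powR_ge0.
have [k xk] := exists_pow2_gt (x `^ p^-1); exists k.
have xE : x = ((x `^ p^-1) `^ p)%R by rewrite -powRrM mulVf ?gt_eqF// powRr1.
rewrite [ltLHS]xE; apply: gt0_ltr_powR => //; rewrite ?nnegrE ?powR_ge0//.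
Qed.

Context (f : dyadic_rect -> R) (p : R).
Hypothesis p0 : (0 < p)%R.
Local Notation leb2 := (@leb2 R).
Local Notation square := (@unit_square R).
Local Notation level := (level_set f).
Local Notation moment := (\int[leb2]_(x in square) (square_fun f x `^ p)).

Lemma level_sum_le :
  \esum_(n in [set: int]) (((2 ^ n) `^ p)%:E * leb2 (level n)) <=
  ((1 - (2 `^ p)^-1)^-1)%:E * moment.
Proof.
have mS : measurable_fun square (fun x => square_fun f x `^ p).
  apply: (measurableT_comp (measurable_poweR _)).
  by apply: measurable_funTS; exact: measurable_square_fun.
have c0 : (0 <= (1 - (2 `^ p)^-1)^-1 :> R)%R.
  by rewrite invr_ge0 subr_ge0 invf_le1 ?powR_gt0// ltW// powR2_gt1.
rewrite -ge0_integralZl//; last by move=> x _; exact: poweR_ge0.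
have m1 n : measurable_fun square (fun x => (\1_(level n) x)%:E : \bar R).
  by apply/measurable_EFinP; apply: measurable_indic; exact: measurable_level_set.
apply: (@le_trans _ _ (\int[leb2]_(x in square)
    \esum_(n in [set: int]) (((2 ^ n) `^ p)%:E * (\1_(level n) x)%:E))).
  rewrite integral_esum//; last 2 first.
  - by move=> n; apply: measurable_funeM.
  - by move=> n x; rewrite mule_ge0// lee_fin powR_ge0.
  apply: le_esum => n _.
  rewrite ge0_integralZl_EFin ?powR_ge0// integral_indic//; last first.
    exact: measurable_level_set.
  by rewrite setIidl// => x [].
apply: ge0_le_integral => //.
- by move=> x _; apply: esum_ge0 => n _; rewrite mule_ge0// lee_fin powR_ge0.
- apply: measurable_fun_esum => [n|n x]; first exact: measurable_funeM.
  by rewrite mule_ge0// lee_fin powR_ge0.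
- exact: measurable_funeM.
move=> x sx; apply: le_trans (esum_pow2_lt_le p0 (square_fun_ge0 f x)).
apply: le_esum => n _; rewrite -EFinM lee_fin ler_wpM2l ?powR_ge0//.
rewrite indicE ler_nat; case: (boolP (x \in _)) => // /[1!inE].
by move=> -[_ /= ->].
Qed.

End layer_cake.

(** * The weights of an atomic decomposition *)

Section atomic_decomposition.
Context {R : realType} (f : dyadic_rect -> R) (p : R).
Local Open Scope ereal_scope.
Local Notation plane := (measurableTypeR R * measurableTypeR R)%type.
Local Notation leb2 := (@leb2 R).
Local Notation square := (@unit_square R).
Local Notation level := (level_set f).
Local Notation cover n := (cover_set (atom_rects f n)).
Local Notation moment := (\int[leb2]_(x in square) (square_fun f x `^ p)).
Hypotheses (p0 : (0 < p)%R) (p2 : (p <= 2)%R) (moment_fin : moment < +oo).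

Let pow2_gt0 (n : int) : (0 < 2 ^ n :> R)%R.
Proof. exact: exprz_gt0. Qed.

Let N := fine moment.

Let moment_ge0 : 0 <= moment.
Proof. by apply: integral_ge0 => x _; exact: poweR_ge0. Qed.

Let momentE : moment = N%:E.
Proof. by rewrite fineK// ge0_fin_numE. Qed.

Let N_ge0 : (0 <= N)%R.
Proof. exact: fine_ge0. Qed.

(** The sum of the series of general term 2 ^ (- k p). *)
Definition geom_const : R := (1 - (2 `^ p)^-1)^-1%R.

Lemma geom_const_ge1 : (1 <= geom_const)%R.
Proof.
have q1 := @powR2_gt1 R _ p0; have q0 : (0 < 2 `^ p :> R)%R by exact: lt_trans q1.
rewrite /geom_const invf_ge1 ?gerBl ?invr_ge0 ?(ltW q0)//.
by rewrite subr_gt0 invf_lt1.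
Qed.

Lemma level_le (n : int) : ((2 ^ n) `^ p)%:E * leb2 (level n) <= (geom_const * N)%:E.
Proof.
rewrite EFinM -momentE (le_trans _ (level_sum_le f p0))//.
apply: (esum_ge_term (a := fun n : int => ((2 ^ n) `^ p)%:E * leb2 (level n))).
by move=> k; rewrite mule_ge0 ?lee_fin ?powR_ge0.
Qed.

Lemma square_fun_ge Q x : drect Q x -> `|f Q|%:E <= square_fun f x.
Proof.
move=> Qx; rewrite -[leLHS]/(`|f Q|%R%:E) -sqrtr_sqr -powR12_sqrt ?sqr_ge0//.
rewrite -poweR_EFin /square_fun; apply: gt0_ler_poweR; rewrite ?in_itv/= ?andbT ?leey//.
- by rewrite lee_fin sqr_ge0.
- by rewrite rect_sum_sqr_ge0.
have -> : (f Q ^+ 2)%:E = (f Q ^+ 2 * \1_(drect Q) x)%:E by rewrite indicE mem_set// mulr1.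
apply: (esum_ge_term (a := fun Q => (f Q ^+ 2 * \1_(drect Q) x)%:E)).
by move=> Q'; rewrite lee_fin mulr_ge0// sqr_ge0.
Qed.

(** Q is contained in the level sets of height below |f_Q|, whereas the measure
    of F_n tends to 0 as n grows; R_n contains Q when n is the last index for
    which F_n fills more than half of Q. *)
Lemma exists_atom_rects Q : f Q != 0%R -> exists n, atom_rects f n Q.
Proof.
move=> fQ0; pose P n := leb2 (drect Q) * 2^-1%:E < leb2 (drect Q `&` level n).
have aQ := @area_gt0 R Q.
have [k1 k1P] := exists_pow2_gt (`|f Q|^-1)%R.
have [k2 k2P] := exists_pow2_powR_gt (2 * (geom_const * N) / area Q)%R p0.
have Pk1 : P (- k1%:Z)%R.
  rewrite /P (_ : drect Q `&` _ = drect Q).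
    by rewrite leb2_drect -EFinM lte_fin; lra.
  apply/setIidl => x Qx; split; first exact: drect_sub_square Qx.
  apply: lt_le_trans (square_fun_ge Qx); rewrite lte_fin.
  by rewrite -invr_expz invf_plt ?posrE ?normr_gt0// exprz_gt0.
have Pk2 : ~ P k2%:Z.
  rewrite /P leb2_drect -EFinM ltNge => /negP; apply.
  apply: (@le_trans _ _ (leb2 (level k2%:Z))).
    apply: le_measure; rewrite ?inE; [|exact: measurable_level_set|by move=> x []].
    by apply: measurableI; [exact: measurable_drect|exact: measurable_level_set].
  have d0 : (0 < (2 ^ k2%:Z) `^ p :> R)%R by rewrite powR_gt0.
  rewrite -(@lee_pmul2l _ ((2 ^ k2%:Z) `^ p)%:E)//.
  rewrite (le_trans (level_le _))// -EFinM lee_fin.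
  by move: k2P; rewrite ltr_pdivrMr// => /ltW; lra.
apply: contrapT => /forallNP noP; apply: Pk2.
have Pj (j : nat) : P (- k1%:Z + j%:Z)%R.
  elim: j => [|j IHj]; first by rewrite addr0.
  rewrite /P ltNge; apply/negP => le_half; apply: (noP (- k1%:Z + j%:Z)%R).
  have jE : (- k1%:Z + j%:Z + 1 = - k1%:Z + j.+1%:Z)%R.
    by rewrite -addrA -PoszD addn1.
  by split; [exact: IHj|rewrite jE; exact: le_half].
by have := Pj (k1 + k2)%N; rewrite PoszD addKr.
Qed.

(** Some level set has positive measure, as it fills half of a rectangle. *)
Lemma moment_gt0 Q : f Q != 0%R -> (0 < N)%R.
Proof.
move=> /exists_atom_rects[n [Qn _]]; rewrite lt_neqAle N_ge0 andbT eq_sym.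
apply/eqP => NE.
have := level_le n; rewrite NE mulr0 leNgt => /negP; apply.
rewrite mule_gt0 ?lte_fin ?powR_gt0//; apply: lt_le_trans (_ : leb2 (drect Q `&` level n) <= _).
  by apply: le_lt_trans Qn; rewrite mule_ge0.
apply: le_measure; rewrite ?inE; [|exact: measurable_level_set|by move=> x []].
by apply: measurableI; [exact: measurable_drect|exact: measurable_level_set].
Qed.

Let t := (p / 2)%R.
Let t0 : (0 < t)%R. Proof. by rewrite divr_gt0. Qed.
Let t1 : (t <= 1)%R. Proof. by rewrite ler_pdivrMr// mul1r. Qed.

(** The bound of [energy_atom_le] on the mean energy of f_n over its shadow. *)
Definition height (n : int) : R := (8 * (2 ^ n) ^+ 2)%R.

Let height_gt0 n : (0 < height n)%R.
Proof. by rewrite mulr_gt0// exprn_gt0. Qed.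

Let m n := fine (leb2 (cover n)).
Let e n := fine (energy (atom f n)).

Let mE n : leb2 (cover n) = (m n)%:E.
Proof. by rewrite fineK// leb2_cover_fin_num. Qed.

Let eE n : energy (atom f n) = (e n)%:E.
Proof.
rewrite fineK// ge0_fin_numE ?energy_ge0//.
by rewrite (le_lt_trans (energy_atom_le f n))// mE -EFinM ltry.
Qed.

Let m_ge0 n : (0 <= m n)%R. Proof. exact: fine_ge0. Qed.
Let e_ge0 n : (0 <= e n)%R. Proof. by rewrite fine_ge0// energy_ge0. Qed.

Let e_le n : (e n <= height n * m n)%R.
Proof. by rewrite -lee_fin EFinM -eE -mE; exact: energy_atom_le. Qed.

(** 576 comes from the maximal estimate, 8 from the energy of the atoms, and
    the last factor from the geometric series. *)
Definition sum_const : R := (576 * 8 `^ t * geom_const)%R.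

Lemma sum_const_ge1 : (1 <= sum_const)%R.
Proof.
rewrite /sum_const -[leLHS]mul1r ler_pM// ?geom_const_ge1//.
rewrite -[leLHS]mul1r ler_pM// ?ler1n// -[leLHS](powRr0 8) ler_powR ?ler1n//.
exact: ltW.
Qed.

Lemma cover_sum_le :
  \esum_(n in [set: int]) (height n `^ t * m n)%:E <= (sum_const * N)%:E.
Proof.
apply: (@le_trans _ _ (\esum_(n in [set: int])
    ((576 * 8 `^ t)%:E * (((2 ^ n) `^ p)%:E * leb2 (level n))))).
  apply: le_esum => n _; rewrite EFinM -mE.
  have -> : (height n `^ t = 8 `^ t * (2 ^ n) `^ p)%R.
    rewrite /height powRM ?exprn_ge0 ?(ltW (pow2_gt0 _))//.
    rewrite -powR_mulrn ?(ltW (pow2_gt0 _))// -powRrM.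
    by rewrite /t (mulrC 2%R) divfK.
  apply: le_trans (lee_wpmul2l _ (cover_atom_rects_le f n)) _.
    by rewrite lee_fin mulr_ge0 ?powR_ge0.
  by rewrite !muleA -!EFinM (_ : _ * 576 = 576 * 8 `^ t * (2 ^ n) `^ p)%R//; ring.
have K0 : (0 <= 576 * 8 `^ t :> R)%R by apply: mulr_ge0; [exact: ler0n|exact: powR_ge0].
rewrite /sum_const; move: (576 * 8 `^ t)%R K0 => K K0.
rewrite esumZl//; last by move=> n; rewrite mule_ge0 ?lee_fin ?powR_ge0.
rewrite -mulrA (EFinM K) lee_wpmul2l ?lee_fin//.
by rewrite EFinM -momentE; exact: level_sum_le.
Qed.

Variable A : R.
Hypotheses (A_ge : (sum_const <= A)%R).

Let A_gt0 : (0 < A)%R.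
Proof. by rewrite (lt_le_trans _ A_ge)// (lt_le_trans _ sum_const_ge1). Qed.

Let k n := (m n `^ (1 - t) / e n `^ (1 - t))%R.

Let k_ge0 n : (0 <= k n)%R.
Proof. by rewrite divr_ge0// powR_ge0. Qed.

Let AN_ge0 : (0 <= (A * N)^-1)%R.
Proof. by rewrite invr_ge0 mulr_ge0// ltW. Qed.

Lemma weight_atom n Q : atom_rects f n Q ->
  weight A p f Q = ((A * N)^-1 * (k n * (f Q ^+ 2 * area Q)))%R.
Proof.
move=> Qn; rewrite (weightE _ _ Qn) /weight_at.
have -> : (fine (Hnorm p f) `^ p = N)%R by rewrite -fine_poweR HnormX.
have -> : (fine (Hnorm 2 (atom f n)) `^ (2 - p) = e n `^ (1 - t))%R.
  rewrite Hnorm2E fine_poweR -powRrM; congr (_ `^ _)%R.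
  by rewrite mulrBr mulVf// mulrC.
by rewrite !lebesgue_dint /= /k /area -/(m n) -/t; congr (_ * _)%R; ring.
Qed.

Lemma weight_eq0 Q : f Q = 0%R -> weight A p f Q = 0%R.
Proof. by move=> fQ0; rewrite /weight fQ0 eqxx. Qed.

Lemma weight_ge0 Q : (0 <= weight A p f Q)%R.
Proof.
have [/weight_eq0 ->//|/exists_atom_rects[n /weight_atom ->]] := eqVneq (f Q) 0%R.
by apply: mulr_ge0 => //; apply: mulr_ge0 => //; exact: energy_term_ge0.
Qed.

(** As e_n = e_n ^ (1 - t) * e_n ^ t, the left-hand side is
    m_n ^ (1 - t) * e_n ^ t, to which the bound of e_n applies. *)
Let k_le n : (k n * e n <= height n `^ t * m n)%R.
Proof.
have [->|en0] := eqVneq (e n) 0%R.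
  by rewrite mulr0 mulr_ge0// powR_ge0.
have en_gt0 : (0 < e n)%R by rewrite lt_neqAle eq_sym en0 e_ge0.
have mn_gt0 : (0 < m n)%R.
  rewrite lt_neqAle eq_sym m_ge0 andbT; apply: contra_neq en0 => mn0.
  by apply/eqP; rewrite eq_le e_ge0 andbT (le_trans (e_le n))// mn0 mulr0.
have split1 (x : R) : (0 < x)%R -> x = (x `^ (1 - t) * x `^ t)%R.
  by move=> x0; rewrite -powRD ?subrK ?powRr1 ?(ltW x0)// gt_eqF ?implybT.
rewrite {1}(split1 _ en_gt0) {1}(split1 _ mn_gt0) /k mulrA divfK ?gt_eqF ?powR_gt0//.
rewrite mulrCA ler_wpM2l ?powR_ge0// -powRM// ?(ltW (height_gt0 _))//.
apply: ge0_ler_powR; rewrite ?nnegrE ?(ltW t0)//.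
exact: le_trans (e_le n).
Qed.

(** A weight is at most the sum over all n of the quantities obtained by
    replacing f by f_n in it; summing first over the rectangles makes the energy
    of f_n appear. *)
Lemma weight_sum_le : \esum_(Q in [set: dyadic_rect]) (weight A p f Q)%:E <= 1.
Proof.
pose w n Q := ((A * N)^-1 * (k n * (atom f n Q ^+ 2 * area Q)))%R.
have w0 n Q : (0 <= w n Q)%R.
  by apply: mulr_ge0 => //; apply: mulr_ge0 => //; exact: energy_term_ge0.
apply: (@le_trans _ _ (\esum_(Q in [set: dyadic_rect])
    \esum_(n in [set: int]) (w n Q)%:E)).
  apply: le_esum => Q _.
  have [/weight_eq0 ->|/exists_atom_rects[n Qn]] := eqVneq (f Q) 0%R.
    by apply: esum_ge0 => n _; rewrite lee_fin.
  rewrite (weight_atom Qn); have -> : (f Q = atom f n Q)%R.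
    by rewrite /atom indicE mem_set// mulr1.
  apply: (@esum_ge_term _ _ (fun n => (w n Q)%:E) n) => j.
  by rewrite lee_fin.
rewrite exchange_esum; last by move=> Q n; rewrite lee_fin.
apply: (@le_trans _ _ (\esum_(n in [set: int])
    (((A * N)^-1)%:E * (height n `^ t * m n)%:E))).
  apply: le_esum => n _.
  have -> : \esum_(Q in [set: dyadic_rect]) (w n Q)%:E =
            ((A * N)^-1 * k n)%:E * energy (atom f n).
    rewrite /energy -esumZl; [|exact: mulr_ge0|].
      by apply: eq_esum => Q _; rewrite -EFinM -(mulrA (A * N)^-1%R (k n)).
    by move=> Q; rewrite lee_fin energy_term_ge0.
  by rewrite eE -!EFinM lee_fin -mulrA ler_wpM2l.
rewrite esumZl//; last by move=> n; rewrite lee_fin mulr_ge0// powR_ge0.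
apply: (@le_trans _ _ (((A * N)^-1)%:E * (sum_const * N)%:E)).
  by rewrite lee_wpmul2l// cover_sum_le.
rewrite -EFinM lee_fin; have [->|N0] := eqVneq N 0%R; first by rewrite !mulr0.
by rewrite invfM mulrACA mulVf// mulr1 mulrC ler_pdivrMr// mul1r.
Qed.

(** Since e_n <= 8 * 4 ^ n * m_n, the ratio (m_n / e_n) ^ (1 - t) in the weight
    is at least (8 * 4 ^ n) ^ (t - 1). *)
Lemma weight_ge n Q : f Q != 0%R -> atom_rects f n Q ->
  (f Q ^+ 2 * area Q / height n `^ (1 - t) <= A * N * weight A p f Q)%R.
Proof.
move=> fQ0 Qn; have N_gt0 := moment_gt0 fQ0.
have fa_gt0 : (0 < f Q ^+ 2 * area Q)%R.
  by rewrite mulr_gt0 ?area_gt0// exprn_even_gt0.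
have en_gt0 : (0 < e n)%R.
  apply: lt_le_trans fa_gt0 _; rewrite -lee_fin -eE.
  have -> : (f Q = atom f n Q)%R by rewrite /atom indicE mem_set// mulr1.
  apply: (@esum_ge_term _ _ (fun Q => (atom f n Q ^+ 2 * area Q)%:E) Q) => Q'.
  by rewrite lee_fin energy_term_ge0.
rewrite (weight_atom Qn) mulVKf ?mulf_neq0 ?gt_eqF//.
rewrite mulrC ler_wpM2r ?(ltW fa_gt0)//.
rewrite /k ler_pdivlMr ?powR_gt0// mulrC ler_pdivrMr ?powR_gt0//.
rewrite -powRM ?(ltW (height_gt0 _))// [leRHS](_ : _ = (height n * m n) `^ (1 - t))%R;
  last by rewrite mulrC.
apply: ge0_ler_powR; rewrite ?nnegrE ?subr_ge0//.
exact: le_trans (e_le n).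
Qed.

Let idx Q : int := xget 0%R [set n | atom_rects f n Q].

Let idxP Q : f Q != 0%R -> atom_rects f (idx Q) Q.
Proof.
move=> /exists_atom_rects[n Qn]; rewrite /idx.
by case: xgetP => [//|/(_ n)]; case.
Qed.

Let Y (x : plane) : \bar R :=
  \esum_(n in [set: int]) (height n `^ t * \1_(cover n) x)%:E.

Let Y_term_ge0 n (x : plane) : 0 <= (height n `^ t * \1_(cover n) x)%:E.
Proof. by rewrite lee_fin mulr_ge0// powR_ge0. Qed.

Let Y_ge0 x : 0 <= Y x.
Proof. by apply: esum_ge0. Qed.

Let measurable_Y_term n D :
  measurable_fun D (fun x : plane => (height n `^ t * \1_(cover n) x)%:E).
Proof.
apply/measurable_EFinP; apply: measurable_funM => //.
by apply: measurable_indic; exact: measurable_cover_set.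
Qed.

Let measurable_Y D : measurable D -> measurable_fun D Y.
Proof. by move=> mD; exact: measurable_fun_esum. Qed.

Let integral_Y : \int[leb2]_(x in square) Y x <= (sum_const * N)%:E.
Proof.
rewrite integral_esum//; apply: le_trans cover_sum_le.
apply: le_esum => n _; under eq_integral do rewrite EFinM.
rewrite ge0_integralZl_EFin ?powR_ge0//; last first.
  by apply/measurable_EFinP; apply: measurable_indic; exact: measurable_cover_set.
rewrite integral_indic//; last exact: measurable_cover_set.
by rewrite setIidl; [rewrite EFinM -mE|exact: cover_set_sub_square].
Qed.

Variable phi : dyadic_rect -> R.

Let cX Q := (mult_op f phi Q ^+ 2 / height (idx Q) `^ (1 - t))%R.

Let cX_ge0 Q : (0 <= cX Q)%R.
Proof. by rewrite divr_ge0 ?sqr_ge0 ?powR_ge0. Qed.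

Let integral_X (Q0 : dyadic_rect) : f Q0 != 0%R ->
  \int[leb2]_(x in square) rect_sum cX x <=
  (A * N)%:E * \esum_(Q in [set: dyadic_rect]) (`|phi Q| ^+ 2 * weight A p f Q)%:E.
Proof.
move=> fQ0; rewrite integral_rect_sum_square// -esumZl; last 2 first.
- by rewrite mulr_ge0// ltW.
- by move=> Q; rewrite lee_fin mulr_ge0 ?sqr_ge0 ?weight_ge0.
apply: le_esum => Q _; rewrite -EFinM lee_fin /cX /mult_op.
have [fQ|fQ] := eqVneq (f Q) 0%R.
  by rewrite (weight_eq0 fQ) fQ !mulr0 expr0n/= !mul0r.
rewrite real_normK ?num_real// [leRHS]mulrCA exprMn.
rewrite -2![leLHS]mulrA ler_wpM2l ?sqr_ge0//.
by rewrite [(_^-1 * _)%R]mulrC mulrA; apply: weight_ge => //; exact: idxP.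
Qed.

(** A point of a rectangle of R_n belongs to the shadow of R_n, where Y is at
    least the t-th power of the height; this compensates the factor by which
    the coefficients of X are smaller than those of the square function. *)
Let square_fun_mult_le (x : plane) :
  square_fun (mult_op f phi) x `^ p <= rect_sum cX x `^ t * Y x `^ (1 - t).
Proof.
rewrite square_fun_poweR -/t.
have -> : Y x `^ (1 - t) = (Y x `^ ((1 - t) / t)) `^ t.
  by rewrite -poweRrM divfK// gt_eqF.
rewrite -poweRM ?rect_sum_ge0 ?poweR_ge0//.
apply: gt0_ler_poweR; rewrite ?in_itv/= ?andbT ?leey ?(ltW t0) ?rect_sum_sqr_ge0
  ?mule_ge0 ?rect_sum_ge0 ?poweR_ge0//.
apply: le_esumZr => [|Q|Q]; first exact: poweR_ge0.
  by rewrite lee_fin mulr_ge0.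
have [xQ|xQ] := pselect (drect Q x); last first.
  by rewrite [\1_(drect Q) x]indicE memNset// !mulr0 mul0e.
have [fQ|fQ] := eqVneq (f Q) 0%R.
  by rewrite /cX /mult_op fQ mulr0 expr0n/= !mul0r mul0e.
rewrite [\1_(drect Q) x]indicE mem_set// !mulr1.
have hY : (height (idx Q) `^ t)%:E <= Y x.
  have -> : (height (idx Q) `^ t = height (idx Q) `^ t * \1_(cover (idx Q)) x)%R.
    by rewrite indicE mem_set ?mulr1//; exists Q => //; exact: idxP.
  exact: (@esum_ge_term _ _ (fun n => (height n `^ t * \1_(cover n) x)%:E)).
apply: (@le_trans _ _ ((cX Q)%:E * (height (idx Q) `^ (1 - t))%:E)).
  by rewrite -EFinM /cX divfK ?gt_eqF ?powR_gt0.
rewrite lee_wpmul2l ?lee_fin//.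
have -> : (height (idx Q) `^ (1 - t))%:E = (height (idx Q) `^ t)%:E `^ ((1 - t) / t).
  by rewrite poweR_EFin -powRrM mulrC divfK// gt_eqF.
apply: gt0_ler_poweR; rewrite ?in_itv/= ?andbT ?leey ?Y_ge0 ?lee_fin ?powR_ge0//.
by rewrite divr_ge0 ?subr_ge0// ltW.
Qed.

Lemma integral_mult_op_le (Q0 : dyadic_rect) : f Q0 != 0%R ->
  \int[leb2]_(x in square) (square_fun (mult_op f phi) x `^ p) <=
  ((A * N)%:E * \esum_(Q in [set: dyadic_rect])
      (`|phi Q| ^+ 2 * weight A p f Q)%:E) `^ t *
  (sum_const * N)%:E `^ (1 - t).
Proof.
move=> fQ0; have N_gt0 := moment_gt0 fQ0.
apply: (@integral_hoelder_poweR _ _ _ _ _ _ (rect_sum cX) Y) => //.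
- exact: measurable_rect_sum.
- exact: measurable_Y.
- apply: (measurableT_comp (measurable_poweR _)).
  by apply: measurable_funTS; exact: measurable_square_fun.
- by move=> x; exact: rect_sum_ge0.
- by move=> x; exact: poweR_ge0.
- apply: mule_ge0; first by rewrite lee_fin mulr_ge0// ltW.
  by apply: esum_ge0 => Q _; rewrite lee_fin mulr_ge0 ?sqr_ge0 ?weight_ge0.
- by rewrite mulr_gt0// (lt_le_trans _ sum_const_ge1).
- exact: integral_X fQ0.
Qed.

End atomic_decomposition.

(** * The norm inequality *)

Theorem theorem3p1 (R : realType) (p : R) (p_gt0 : 0 < p) (p_le2 : p <= 2) :
  exists A : R, 0 < A /\
    forall f : dyadic_rect -> R, Hspace p f -> f <> (fun=> 0) ->
      [/\ forall Q, 0 <= weight A p f Q,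
          (\esum_(Q in [set: dyadic_rect]) (weight A p f Q)%:E <= 1)%E
        & forall phi : dyadic_rect -> R, bounded_fun phi ->
            (Hnorm p (mult_op f phi) <=
              A%:E * Hnorm p f *
              (\esum_(Q in [set: dyadic_rect])
                 (`|phi Q| ^+ 2 * weight A p f Q)%:E) `^ 2^-1)%E].
Proof.
have [C CE C1] : exists2 C : R, sum_const p = C & 1 <= C.
  by exists (sum_const p) => //; exact: sum_const_ge1.
have C0 : 0 < C := lt_le_trans ltr01 C1.
(* A ^ t = C, so that A ^ p = C ^ 2 absorbs A ^ t * C ^ (1 - t) *)
pose A := C `^ (2 / p).
have CA : C <= A.
  rewrite -[leLHS](powRr1 (ltW C0)); apply: ler_powR => //.
  by rewrite ler_pdivlMr// mul1r.
have A0 : 0 < A by exact: lt_le_trans CA.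
exists A; split => // f Hf f0.
have pinv0 : p^-1 != 0 by rewrite invr_eq0 gt_eqF.
have moment_fin := lty_poweRy pinv0 Hf.
have [Q0 fQ0] : exists Q, f Q != 0.
  apply: contrapT => /forallNP f0'; apply: f0; apply/funext => Q.
  by apply/eqP/negPn/negP; exact: f0'.
have A_ge : sum_const p <= A by rewrite CE.
have w0 := weight_ge0 p_gt0 moment_fin A_ge.
split => //; first exact: weight_sum_le.
move=> phi _.
set W := \esum_(Q in _) (`|phi Q| ^+ 2 * weight A p f Q)%:E.
have W0 : (0 <= W)%E.
  by apply: esum_ge0 => Q _; rewrite lee_fin mulr_ge0 ?sqr_ge0.
have H0 (g : dyadic_rect -> R) : (0 <= Hnorm p g)%E by exact: poweR_ge0.
have := integral_mult_op_le p_gt0 p_le2 moment_fin A_ge phi fQ0.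
rewrite -/W CE -(HnormX _ p_gt0) -(HnormX _ p_gt0).
have NE : (Hnorm p f `^ p = (fine (Hnorm p f `^ p))%:E)%E.
  by rewrite fineK// ge0_fin_numE ?poweR_ge0// poweR_lty.
set N := fine _ in NE *; move: (poweR_ge0 (Hnorm p f) p); rewrite NE lee_fin => N0.
move=> le_int.
have key : (Hnorm p (mult_op f phi) `^ p <=
    (A%:E * Hnorm p f * W `^ 2^-1) `^ p)%E.
  apply: (le_trans le_int).
  rewrite !poweRM ?mule_ge0 ?poweR_ge0 ?lee_fin ?mulr_ge0 ?(ltW A0) ?(ltW C0)//.
  rewrite NE -poweRrM (mulrC 2^-1) muleAC lee_wpmul2r ?poweR_ge0//.
  rewrite !poweR_EFin -!EFinM lee_fin !powRM ?(ltW A0) ?(ltW C0)//.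
  have -> : A `^ (p / 2) = C.
    rewrite /A -powRrM (_ : _ * _ = 1) ?powRr1 ?(ltW C0)//.
    by field; rewrite gt_eqF.
  have -> : A `^ p = C * C.
    by rewrite /A -powRrM divfK ?gt_eqF// powR_mulrn ?(ltW C0)// expr2.
  have NN : N = N `^ (p / 2) * N `^ (1 - p / 2).
    by rewrite -powRD ?subrKC ?powRr1// oner_eq0.
  rewrite mulrACA -NN ler_wpM2r// ler_wpM2l ?(ltW C0)//.
  by apply: ler1_powR => //; rewrite gerBl divr_ge0// ltW.
have rootE (z : \bar R) : (0 <= z)%E -> z = ((z `^ p) `^ p^-1)%E.
  by move=> z0; rewrite -poweRrM mulfV ?gt_eqF// poweRe1.
rewrite [leLHS]rootE// [leRHS]rootE; last first.
  by rewrite !mule_ge0 ?poweR_ge0// lee_fin ltW.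
apply: gt0_ler_poweR => //; rewrite ?in_itv/= ?andbT ?leey ?poweR_ge0//.
by rewrite invr_ge0 ltW.
Qed.
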